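(* Let $r=2$ or let $r\ge3$ be odd, and let $H$ be an $r$-graph. Suppose that, for some positive integer $m$, $H$ has a subgraph with $2m$ edges that is non-positive and $2$-connected, and that every other subgraph of $H$ with a positive even number of edges not exceeding $2m$ is either non-positive and $2$-connected or has a vertex of degree $1$. Then $H$ is not common.
   Context: An $r$-graph is a finite $r$-uniform hypergraph; subgraphs are given by subsets of edges (with the vertices they cover), and degrees are computed within the subgraph. For an $r$-graph $G$ and a symmetric measurable $W:[0,1]^r\to\mathbb{R}$ bounded, $t_G(W)=\int_{[0,1]^{V(G)}}\prod_{\{u_1,\dots,u_r\}\in E(G)}W(x_{u_1},\dots,x_{u_r})\,dx$. $G$ is positive if $t_G(W)\ge0$ for every symmetric measurable $W:[0,1]^r\to[-1,1]$. $H$ is common if $t_H(W)+t_H(1-W)\ge2^{1-\mathrm{e}(H)}$ for every symmetric measurable $W:[0,1]^r\to[0,1]$, where $\mathrm{e}(H)$ is the number of edges. For $r\ge3$, an $r$-graph is $2$-connected if it is connected and removing any single vertex or any single edge does not disconnect it; for $r=2$, $2$-connected has its usual graph meaning (not disconnected by removing a single vertex). *)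

(* Defs.v *)
From HB Require Import structures.
From mathcomp Require Import all_boot all_order all_algebra all_fingroup.
From mathcomp Require Import all_classical all_reals all_analysis.

Set Implicit Arguments.
Unset Strict Implicit.
Unset Printing Implicit Defensive.

Import Order.TTheory GRing.Theory Num.Theory.
Import numFieldNormedType.Exports.

(* An r-graph whose vertices form a finite subset of V. *)
Record rhypergraph (V : finType) (r : nat) := RGraph {
  vset : {set V};
  eset : {set {set V}};
  edge_uniform : [forall (e | e \in eset), (e \subset vset) && (#|e| == r)]
}.

Section Structure.
Variable V : finType.

Definition adjacent (E : {set {set V}}) : rel V :=
  [rel u v | [exists e in E, (u \in e) && (v \in e)]].

(* Connectivity of a hypergraph that need not be uniform; a vertex of A lying
   in no edge is a component of its own. *)
Definition connected_hypergraph (A : {set V}) (E : {set {set V}}) : bool :=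
  [forall u in A, forall v in A, connect (adjacent E) u v].

Variable r : nat.
Implicit Types (F G H : rhypergraph V r).

(* Deleting a vertex v shrinks every edge e to e :\ v; deleting an edge keeps
   all the vertices. *)
Definition two_connected G : Prop :=
  [/\ connected_hypergraph (vset G) (eset G),
      (forall v, v \in vset G ->
         connected_hypergraph (vset G :\ v) [set e :\ v | e in eset G]) &
      (3 <= r)%N -> forall e, e \in eset G ->
         connected_hypergraph (vset G) (eset G :\ e)].

Definition subgraph F H : Prop :=
  eset F \subset eset H /\ vset F = finset.cover (eset F).

Definition vdegree G (v : V) : nat := #|[set e in eset G | v \in e]|.

End Structure.

Local Open Scope classical_set_scope.
Local Open Scope ring_scope.

Definition tuple_cons d (T : measurableType d) n (p : T * n.-tuple T) :
  n.+1.-tuple T := [tuple of p.1 :: p.2].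

Lemma measurable_tuple_cons d (T : measurableType d) n :
  measurable_fun [set: T * n.-tuple T] (@tuple_cons d T n).
Proof. exact: measurable_cons measurable_fst measurable_snd. Qed.

HB.instance Definition _ d (T : measurableType d) n :=
  isMeasurableFun.Build _ _ _ _ (@tuple_cons d T n)
    (@measurable_tuple_cons d T n).

(* The n-fold product of P, on n-tuples with the product sigma-algebra. *)
Fixpoint power_prob d (T : measurableType d) (R : realType)
    (P : probability T R) n : probability (n.-tuple T) R :=
  if n is n'.+1 then distribution (P \x power_prob P n')%E (@tuple_cons d T n')
  else dirac [tuple].

(* The uniform probability on [0, 1] is Lebesgue measure restricted to [0, 1],
   so this is the measure dx of [0, 1]^n. *)
Definition unit_cube_prob (R : realType) n :
    probability (n.-tuple (measurableTypeR R)) R :=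
  power_prob (uniform_prob (@ltr01 R)) n.

Definition unit_cube (R : realType) n : set (n.-tuple (measurableTypeR R)) :=
  [set x | forall i, 0 <= (tnth x i : R) <= 1].

(* Kernels are functions on R^r of which only the values on [0, 1]^r matter. *)
Definition symmetric_kernel (R : realType) r (a b : R)
    (W : r.-tuple (measurableTypeR R) -> R) : Prop :=
  [/\ measurable_fun (@unit_cube R r) W,
      (forall (s : 'S_r) x, unit_cube x ->
         W [tuple tnth x (s i) | i < r] = W x) &
      forall x, unit_cube x -> a <= W x <= b].

Section Density.
Variables (R : realType) (V : finType) (r : nat).
Local Notation RT := (measurableTypeR R).
Implicit Types (G : rhypergraph V r) (W : r.-tuple RT -> R).

(* The coordinate x_v of a point x of [0, 1]^(vset G); the default 0 is never
   reached for v in vset G. *)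
Definition vcoord G (x : #|vset G|.-tuple RT) (v : V) : RT :=
  nth (0 : R) x (index v (enum (vset G))).

(* (x_{u_1}, ..., x_{u_r}) for e = {u_1, ..., u_r}, in the order of enum e,
   which is immaterial for a symmetric kernel. *)
Definition edge_point G (x : #|vset G|.-tuple RT) (e : {set V}) : r.-tuple RT :=
  [tuple nth (0 : R) [seq vcoord x v | v <- enum e] i | i < r].

Definition hom_density G W : R :=
  \int[unit_cube_prob R #|vset G|]_(x in @unit_cube R #|vset G|)
    \prod_(e in eset G) W (edge_point x e).

Definition positive_hypergraph G : Prop :=
  forall W, symmetric_kernel (-1) 1 W -> 0 <= hom_density G W.

Definition common_hypergraph G : Prop :=
  forall W, symmetric_kernel 0 1 W ->
    hom_density G W + hom_density G (fun x => 1 - W x)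
      >= 2 ^ (1 - (#|eset G|)%:Z).

End Density.

Arguments positive_hypergraph R {V r} G.
Arguments common_hypergraph R {V r} G.

(* Main.v *)
Require Import Defs.
From HB Require Import structures.
From mathcomp Require Import all_boot all_order all_algebra all_fingroup.
From mathcomp Require Import all_classical all_reals all_analysis.
From mathcomp Require Import measurable_realfun ring lra zify.

(* With [W = (1 + c U) / 2], the sum [t_H(W) + t_H(1 - W)] is [2 ^ (1 - e(H))]
   times the sum of [c ^ e(F) * t_F(U)] over the subgraphs [F] of [H] with an
   even number of edges, so for small [c] it suffices that [t_F(U)] is
   nonpositive when [0 < e(F) <= 2 m], and negative for one [F] with [2 m]
   edges.
   Sampling points of [0, 1] replaces a kernel witnessing non-positivity by a
   kernel on a finite set.  On finite kernels, tensor products multiply all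
   densities, and a block-diagonal mixture adds the densities of connected
   hypergraphs up to a positive factor.  Hence finitely many connected
   non-positive hypergraphs have a common kernel [U] with negative densities.
   Finally tensor [U] with [g(x_1) ... g(x_r)] where [g] has mean 0 and positive
   higher moments: the density of [F] is multiplied by the product of the
   moments of [g] of order [deg v], which is zero if [F] has a vertex of degree
   1 and positive otherwise; and a 2-connected [F] with at least two edges has no
   such vertex. *)

Set Implicit Arguments.
Unset Strict Implicit.
Unset Printing Implicit Defensive.

Import Order.TTheory GRing.Theory Num.Theory.
Import numFieldNormedType.Exports.

Local Open Scope ring_scope.

(** * Kernels on finite sets *)

Section FiniteKernels.
Variables (R : realType) (V : finType).
Implicit Types (X Y J : finType) (E F : {set {set V}}).

(* A kernel reads the list of the images of the vertices of an edge; the density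
   averages over all maps [V -> X], including the vertices covered by no edge. *)
Definition discrete_kernel X (U : seq X -> R) : Prop :=
  [/\ (0 < #|X|)%N, forall s t, perm_eq s t -> U s = U t &
      forall s, `|U s| <= 1].

Definition discrete_weight X (U : seq X -> R) E (phi : {ffun V -> X}) : R :=
  \prod_(e in E) U [seq phi v | v <- enum e].

Definition discrete_density X (U : seq X -> R) E : R :=
  (\sum_(phi : {ffun V -> X}) discrete_weight U E phi) / #|X|%:R ^+ #|V|.

Definition tensor X Y (U : seq X -> R) (U' : seq Y -> R) (s : seq (X * Y)) :=
  U [seq x.1 | x <- s] * U' [seq x.2 | x <- s].

Lemma discrete_kernel_tensor X Y (U : seq X -> R) (U' : seq Y -> R) :
  discrete_kernel U -> discrete_kernel U' -> discrete_kernel (tensor U U').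
Proof.
move=> [X0 Us Ub] [Y0 U's U'b]; split=> [|s t st|s].
- by rewrite card_prod muln_gt0 X0.
- by rewrite /tensor (Us _ _ (perm_map _ st)) (U's _ _ (perm_map _ st)).
- by rewrite /tensor normrM mulr_ile1.
Qed.

Lemma discrete_kernel1 X : (0 < #|X|)%N -> discrete_kernel (fun _ : seq X => 1).
Proof. by move=> X0; split=> // s; rewrite normr1. Qed.

Lemma discrete_density1 X E :
  (0 < #|X|)%N -> discrete_density (fun _ : seq X => 1) E = 1.
Proof.
move=> X0; rewrite /discrete_density /discrete_weight.
transitivity ((\sum_(phi : {ffun V -> X}) 1) / #|X|%:R ^+ #|V| : R).
  by congr (_ / _); apply: eq_bigr => phi _; rewrite /discrete_weight big1.
rewrite sumr_const card_ffun -natrX divff // pnatr_eq0 -lt0n expn_gt0 X0 //.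
Qed.

Lemma sum_ffun_pair X Y (f : {ffun V -> X} -> {ffun V -> Y} -> R) :
  \sum_(phi : {ffun V -> X * Y}) f [ffun v => (phi v).1] [ffun v => (phi v).2]
  = \sum_a \sum_b f a b.
Proof.
rewrite pair_bigA /=.
rewrite (reindex (fun p : {ffun V -> X} * {ffun V -> Y} =>
  [ffun v => (p.1 v, p.2 v)])) /=.
  apply: eq_bigr => -[a b] _ /=; congr (f _ _); apply/ffunP => v;
    by rewrite !ffunE.
exists (fun phi => ([ffun v => (phi v).1], [ffun v => (phi v).2])) => [[a b]|phi] _.
  by congr pair; apply/ffunP => v; rewrite !ffunE.
by apply/ffunP => v; rewrite !ffunE; case: (phi v).
Qed.

Lemma discrete_density_tensor X Y (U : seq X -> R) (U' : seq Y -> R) E :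
  discrete_density (tensor U U') E = discrete_density U E * discrete_density U' E.
Proof.
rewrite /discrete_density mulrACA -invfM -exprMn -natrM -card_prod; congr (_ / _).
rewrite big_distrlr -sum_ffun_pair; apply: eq_bigr => phi _.
rewrite /= /discrete_weight /tensor -big_split; apply: eq_bigr => e _ /=.
by congr (U _ * U' _); rewrite -map_comp; apply: eq_map => v /=; rewrite ffunE.
Qed.

Lemma discrete_density_bound X (U : seq X -> R) E :
  discrete_kernel U -> `|discrete_density U E| <= 1.
Proof.
move=> [X0 _ Ub]; rewrite /discrete_density normrM normfV normrX normr_nat.
rewrite ler_pdivrMr ?exprn_gt0 ?ltr0n // mul1r.
apply: le_trans (ler_norm_sum _ _ _) _.
rewrite -natrX -card_ffun -sumr_const; apply: ler_sum => phi _.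
by rewrite /discrete_weight normr_prod prodr_ile1 // => e _; rewrite normr_ge0 Ub.
Qed.

Lemma discrete_densityZ X (U : seq X -> R) (c : R) E :
  discrete_density (fun s => c * U s) E = c ^+ #|E| * discrete_density U E.
Proof.
rewrite /discrete_density mulrA; congr (_ / _); rewrite mulr_sumr.
apply: eq_bigr => phi _; rewrite /discrete_weight big_split /=.
by rewrite prodr_const.
Qed.

(** * Block-diagonal mixtures of kernels *)

(** Block [j] of [X * J] carries [Us j], and lists meeting two blocks get 0. The empty list passes
    the test for every [j], so its value is an arbitrary choice of [pick]; this is why the edges are
    later required to be nonempty. *)
Definition mixture X J (Us : J -> seq X -> R) (s : seq (X * J)) : R :=
  if [pick j | all (fun x => x.2 == j) s] is Some j
  then Us j [seq x.1 | x <- s] else 0.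

Lemma discrete_kernel_mixture X J (Us : J -> seq X -> R) :
  (0 < #|J|)%N -> (forall j, discrete_kernel (Us j)) ->
  discrete_kernel (mixture Us).
Proof.
move=> J0 kU; split=> [|s t st|s].
- have /card_gt0P[j _] := J0; have [X0 _ _] := kU j.
  by rewrite card_prod muln_gt0 X0.
- rewrite /mixture (eq_pick (Q := fun j => all (fun x => x.2 == j) t)); last first.
    by move=> j; exact: perm_all.
  case: pickP => // j _; have [_ Us_ _] := kU j.
  by apply: Us_; exact: perm_map.
- rewrite /mixture; case: pickP => [j _|_]; last by rewrite normr0.
  by have [_ _ ->] := kU j.
Qed.

Lemma connected_const (A : {set V}) E (T : Type) (f : V -> T) :
  connected_hypergraph A E ->
  (forall e u v, e \in E -> u \in e -> v \in e -> f u = f v) ->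
  forall u v, u \in A -> v \in A -> f u = f v.
Proof.
move=> /'forall_in_'forall_in_idP cA fE u v uA vA.
have /connectP[p] := cA u uA v vA.
elim: p u {uA} => [|w p IH] u /=; first by move=> _ ->.
move=> /andP[/existsP[e /and3P[eE ue we]] pp] vl.
by rewrite (fE e u w) //; exact: IH.
Qed.

(** A nonzero weight forces the labels [b] to agree on each edge, hence, by connectedness, on the
    whole cover. The cover being nonempty, at most one [j] contributes to the sum. Labels of
    uncovered vertices stay free, which is the [predT] branch. *)
Lemma discrete_weight_mixture X J (Us : J -> seq X -> R) E
  (a : {ffun V -> X}) (b : {ffun V -> J}) :
  E != finset.set0 -> (forall e, e \in E -> e != finset.set0) ->
  connected_hypergraph (finset.cover E) E ->
  discrete_weight (mixture Us) E [ffun v => (a v, b v)] =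
  \sum_j (b \in family (fun v =>
      if v \in finset.cover E then pred1 j else predT))%:R * discrete_weight (Us j) E a.
Proof.
move=> E0 e0 cE.
have [e1 e1E] := set0Pn _ E0.
have [v1 v1e] := set0Pn _ (e0 _ e1E).
have v1E : v1 \in finset.cover E by apply/bigcupP; exists e1.
have famP j : reflect (forall v, v \in finset.cover E -> b v = j)
    (b \in family (fun v => if v \in finset.cover E then pred1 j else predT)).
  apply: (iffP familyP) => [h v vE|h v].
    by have := h v; rewrite vE => /eqP.
  by case: ifP => // vE; apply/eqP; exact: h.
(* Either [b] is constant on every edge, and then equal to [b v1] on the cover, or some edge carries
   two labels and both sides vanish. *)
have [/forallP h|/forallPn[e]] :=
  boolP [forall e in E, [forall u in e, [forall v in e, b u == b v]]].
  have bc : forall u v, u \in finset.cover E -> v \in finset.cover E -> b u = b v.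
    apply: (connected_const cE) => e u v eE ue ve.
    have := h e; rewrite eE => /forallP/(_ u); rewrite ue => /forallP/(_ v).
    by rewrite ve => /eqP.
  rewrite (bigD1 (b v1)) //= big1 ?addr0; last first.
    move=> j jb; case: famP => [/(_ _ v1E) bj|_]; last by rewrite mul0r.
    by rewrite bj eqxx in jb.
  have -> : b \in family (fun v =>
      if v \in finset.cover E then pred1 (b v1) else predT).
    by apply/famP => v vE; apply: bc.
  rewrite mul1r; apply: eq_bigr => e eE; rewrite /mixture.
  (* As the edge is nonempty, [b v1] is the only label that passes the test, so [pick] must return
     it. *)
  have ej j : all (fun x => x.2 == j)
      [seq [ffun v => (a v, b v)] v | v <- enum e] = (j == b v1).
    have [u ue] := set0Pn _ (e0 _ eE).
    have uE : u \in finset.cover E by apply/bigcupP; exists e.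
    apply/allP/eqP => [hh|->].
      have /hh : [ffun v => (a v, b v)] u \in
          [seq [ffun v => (a v, b v)] v | v <- enum e].
        by apply: map_f; rewrite mem_enum.
      by rewrite ffunE /= => /eqP <-; apply: bc.
    move=> _ /mapP[w we ->]; rewrite ffunE /=; apply/eqP; apply: bc => //.
    by rewrite mem_enum in we; apply/bigcupP; exists e.
  rewrite (eq_pick ej); case: pickP => [j /eqP ->|/(_ (b v1))]; last by rewrite eqxx.
  by congr Us; rewrite -map_comp; apply: eq_map => v /=; rewrite ffunE.
rewrite negb_imply => /andP[eE /forallPn[u]].
rewrite negb_imply => /andP[ue /forallPn[v]].
rewrite negb_imply => /andP[ve buv].
rewrite big1 => [|j _]; last first.
  case: famP => [hj|_]; last by rewrite mul0r.
  by move: buv; rewrite !hj ?eqxx //; apply/bigcupP; exists e.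
rewrite /discrete_weight (bigD1 e) //= /mixture.
case: pickP => [j /allP jj|_]; last by rewrite mul0r.
have uj : b u == j.
  have := jj ([ffun v => (a v, b v)] u).
  by rewrite map_f ?mem_enum // ffunE => /(_ isT).
have vj : b v == j.
  have := jj ([ffun v => (a v, b v)] v).
  by rewrite map_f ?mem_enum // ffunE => /(_ isT).
by rewrite (eqP uj) (eqP vj) eqxx in buv.
Qed.

Lemma card_ffun_const_on J (A : {set V}) (j : J) :
  (#|family (fun v => if v \in A then pred1 j else predT)| =
   #|J| ^ #|~: A|)%N.
Proof.
rewrite card_family foldrE big_map big_enum /=.
rewrite (bigID [in A]) /= big1 ?mul1n => [|v ->]; last by rewrite card1.
rewrite (eq_bigr (fun=> #|J|)) => [|v /negbTE ->//].
rewrite (eq_bigl [in ~: A]) => [|v]; last by rewrite inE.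
by rewrite prod_nat_const.
Qed.

(** The free labels of uncovered vertices contribute [#|J|] to the power of their number, which
    cancels part of the normalisation [#|J| ^ #|V|] and leaves only the power for the cover. *)
Lemma discrete_density_mixture X J (Us : J -> seq X -> R) E :
  (0 < #|J|)%N -> E != finset.set0 -> (forall e, e \in E -> e != finset.set0) ->
  connected_hypergraph (finset.cover E) E ->
  discrete_density (mixture Us) E =
    (\sum_j discrete_density (Us j) E) / #|J|%:R ^+ #|finset.cover E|.
Proof.
move=> J0 E0 e0 cE; rewrite {1}/discrete_density.
have -> : \sum_(phi : {ffun V -> X * J}) discrete_weight (mixture Us) E phi =
   \sum_(a : {ffun V -> X}) \sum_(b : {ffun V -> J})
     discrete_weight (mixture Us) E [ffun v => (a v, b v)].
  rewrite -sum_ffun_pair; apply: eq_bigr => phi _; congr discrete_weight.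
  by apply/ffunP => v; rewrite !ffunE; case: (phi v).
under eq_bigr do under eq_bigr do rewrite discrete_weight_mixture //.
have -> : \sum_(a : {ffun V -> X}) \sum_(b : {ffun V -> J}) \sum_j
    (b \in family (fun v => if v \in finset.cover E then pred1 j else predT))%:R
     * discrete_weight (Us j) E a =
   #|J|%:R ^+ #|~: finset.cover E| *
   \sum_j \sum_(a : {ffun V -> X}) discrete_weight (Us j) E a.
  rewrite mulr_sumr exchange_big; under eq_bigr do rewrite exchange_big /=.
  rewrite exchange_big /=; apply: eq_bigr => j _.
  rewrite exchange_big mulr_sumr /=; apply: eq_bigr => a _.
  rewrite -mulr_suml; congr (_ * _).
  under eq_bigr do rewrite mulrb.
  by rewrite -big_mkcond sumr_const card_ffun_const_on natrX.
rewrite card_prod natrM exprMn /discrete_density -mulr_suml.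
have J0' : (#|J|%:R : R) != 0 by rewrite pnatr_eq0 -lt0n.
have -> : #|J|%:R ^+ #|V| =
    #|J|%:R ^+ #|finset.cover E| * #|J|%:R ^+ #|~: finset.cover E| :> R.
  by rewrite -exprD cardsC.
have cancel (a b x S : R) : b != 0 -> b * S / (x * (a * b)) = S / x / a.
  move=> b0; rewrite !invfM -[RHS]mul1r -(divff b0).
  by move: b^-1 a^-1 x^-1 => b' a' x'; ring.
by rewrite cancel // expf_neq0.
Qed.

(** The kernels come as a list so that a combination with natural coefficients can be encoded by
    repetition. The mixture is indexed by positions, so the default [fun=> 1] is never read. *)
Lemma discrete_density_combination X (l : seq (seq X -> R)) :
  (0 < size l)%N ->
  (forall i, (i < size l)%N -> discrete_kernel (nth (fun=> 1) l i)) ->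
  exists Y (U : seq Y -> R), discrete_kernel U /\
    forall E, E != finset.set0 -> (forall e, e \in E -> e != finset.set0) ->
      connected_hypergraph (finset.cover E) E ->
      discrete_density U E =
        (\sum_(W <- l) discrete_density W E) / (size l)%:R ^+ #|finset.cover E|.
Proof.
move=> l0 kl; exists (X * 'I_(size l))%type.
exists (mixture (fun j : 'I_(size l) => nth (fun=> 1) l j)); split.
  by apply: discrete_kernel_mixture => [|j]; [rewrite card_ord | exact: kl].
move=> E E0 e0 cE; rewrite discrete_density_mixture ?card_ord //; congr (_ / _).
by rewrite (big_nth (fun=> 1)) big_mkord.
Qed.

(** * Making finitely many densities negative at once *)

(** Add up integers exceeding each [1 / (- v i)]: since [v] is negative on [L], enlarging [M]
    preserves the bounds already obtained. *)
Lemma common_negative_lower_bound (I : eqType) (L : seq I) (v : I -> R) :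
  (forall i, i \in L -> v i < 0) ->
  exists2 M : nat, (0 < M)%N & forall i, i \in L -> M%:R * v i <= -1.
Proof.
elim: L => [|i L IH] vL; first by exists 1%N.
have [j jL|M M0 ML] := IH; first by apply: vL; rewrite inE jL orbT.
have vi : v i < 0 by apply: vL; rewrite inE eqxx.
have [k] : exists k : nat, (- v i)^-1 < k%:R.
  by exists (Num.truncn (- v i)^-1).+1; exact: truncnS_gt.
rewrite -(ltr_pM2r (x := - v i)) ?oppr_gt0 // mulVf ?oppr_eq0 ?lt_eqF // => kv.
exists (M + k)%N => [|j]; first by rewrite addn_gt0 M0.
rewrite inE natrD => /predU1P[->|jL].
  have : M%:R * v i <= 0 by rewrite nmulr_lle0.
  by lra.
have := ML j jL; have : k%:R * v j <= 0.
  by rewrite mulr_ge0_le0 // ltW // vL // inE jL orbT.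
by lra.
Qed.

(* The vector [v] is negative on [L] and [w] is negative at [k].  With
   [p / n] close to [- w k], the polynomial [N (p + n w)^2 v + n^2 w] has
   nonnegative coefficients, and its first term is nonpositive on [L] and
   nearly vanishes at [k]. *)
Lemma negative_combination (I : eqType) (L : seq I) (k : I) (v w : I -> R) :
  (forall i, i \in L -> v i < 0) -> w k < 0 ->
  `|v k| <= 1 -> `|w k| <= 1 ->
  exists N p n : nat, (0 < n)%N /\
    forall i, i \in k :: L ->
      (N * p ^ 2)%:R * v i + (2 * N * p * n)%:R * (v i * w i)
        + (N * n ^ 2)%:R * (v i * w i * w i) + (n ^ 2)%:R * w i < 0.
Proof.
move=> vL wk vk1 wk1; have [M M0 ML] := common_negative_lower_bound vL.
pose t := - w k; have t0 : 0 < t by rewrite oppr_gt0.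
have t1 : t <= 1 by rewrite /t; move: wk1; rewrite ler_norml; lra.
(* [N t > M] serves the indices with [w i > 0]; [n t > N + 2] makes [n ^ 2 t] exceed the bound [N]
   on the first term at [k]; and [p], the integer part of [n t], satisfies [|p - n t| < 1]. *)
pose N := (Num.truncn (M%:R / t)).+1.
have NM : M%:R < N%:R * t by rewrite -ltr_pdivrMr // truncnS_gt.
pose n := (Num.truncn ((N%:R + 2) / t)).+1.
have nN : N%:R + 2 < n%:R * t by rewrite -ltr_pdivrMr // truncnS_gt.
pose p := Num.truncn (n%:R * t).
have n0 : 0 < n%:R :> R by rewrite ltr0n.
have n1 : 1 <= n%:R :> R by rewrite ler1n.
have N0 : 0 < N%:R :> R by rewrite ltr0n.
have M0' : 0 < M%:R :> R by rewrite ltr0n.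
have p_le : p%:R <= n%:R * t by rewrite truncn_le // mulr_ge0 // ltW.
have p_gt : n%:R * t < p%:R + 1 by rewrite natr1 truncnS_gt.
have wkE : w k = - t by rewrite opprK.
clearbody p n N t.
exists N, p, n; split=> [|i iL]; first by rewrite -(ltr0n R).
suff : N%:R * (p%:R + n%:R * w i) ^+ 2 * v i + n%:R ^+ 2 * w i < 0.
  by rewrite !natrM; congr (_ < _); ring.
have [->|ik] := eqVneq i k.
  rewrite wkE.
  pose d := p%:R + n%:R * - t.
  have d2 : d ^+ 2 <= 1 by rewrite /d; nra.
  have d2v : d ^+ 2 * v k <= 1.
    apply: le_trans (ler_norm _) _; rewrite normrM ger0_norm ?sqr_ge0 //.
    by rewrite mulr_ile1 // sqr_ge0.
  have : N%:R * (d ^+ 2 * v k) <= N%:R by rewrite ler_piMr // ltW.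
  have : n%:R * t <= n%:R * (n%:R * t) by rewrite ler_peMl // mulr_ge0 // ltW.
  by rewrite -/d; lra.
have {iL} iL : i \in L by move: iL; rewrite inE (negbTE ik).
have vi := vL i iL; have Mi := ML i iL.
have p0 : 0 < p%:R :> R by lra.
have sq_v : N%:R * (p%:R + n%:R * w i) ^+ 2 * v i <= 0.
  by rewrite mulr_ge0_le0 ?(ltW vi) // mulr_ge0 ?sqr_ge0 // ltW.
have [wi|wi|->] := ltgtP (w i) 0.
- have : n%:R ^+ 2 * w i < 0 by rewrite pmulr_rlt0 // exprn_gt0.
  by lra.
(* For [w i > 0] the square is at least [4 p n w i], so the first term is bounded by a multiple of
   [w i]. It beats [n ^ 2 w i] because [4 N p v i <= 2 n M v i <= - 2 n]. *)
- have h1 : 4 * (p%:R * (n%:R * w i)) <= (p%:R + n%:R * w i) ^+ 2.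
    by have := sqr_ge0 (p%:R - n%:R * w i); lra.
  have h2 : N%:R * (p%:R + n%:R * w i) ^+ 2 * v i <=
      N%:R * (4 * (p%:R * (n%:R * w i))) * v i.
    by rewrite ler_nM2r // ler_pM2l.
  have h3 : n%:R * M%:R <= 2 * (N%:R * p%:R) :> R.
    apply: (@le_trans _ _ (n%:R * (N%:R * t))); first by rewrite ler_pM2l // ltW.
    by rewrite mulrCA [leRHS]mulrCA ler_pM2l //; lra.
  have h4 : 4 * (N%:R * p%:R) * v i <= 2 * (n%:R * M%:R) * v i.
    by rewrite ler_nM2r //; lra.
  have h5 : n%:R * (M%:R * v i) <= - n%:R by rewrite -mulrN1 ler_pM2l.
  have h6 : (n%:R * w i) * (4 * (N%:R * p%:R) * v i + n%:R) < 0.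
    by rewrite pmulr_rlt0 ?mulr_gt0 //; lra.
  by lra.
- by rewrite !mulr0 !addr0 pmulr_rlt0 // mulr_gt0 // exprn_gt0.
Qed.

(** Induction on [L]: [v] serves the tail and [w] the new head [F]. The polynomial of
    [negative_combination] in the densities of [v] and [w] is realised by tensors (products) and a
    mixture (sum). *)
Lemma simultaneously_negative (L : seq {set {set V}}) :
  (forall E, E \in L -> [/\ E != finset.set0,
     forall e, e \in E -> e != finset.set0 &
     connected_hypergraph (finset.cover E) E]) ->
  (forall E, E \in L -> exists X (U : seq X -> R),
     discrete_kernel U /\ discrete_density U E < 0) ->
  exists X (U : seq X -> R),
    discrete_kernel U /\ forall E, E \in L -> discrete_density U E < 0.
Proof.
elim: L => [|F L IH] Lc Ln.
  exists unit, (fun=> 1); split=> //.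
  by apply: discrete_kernel1; rewrite card_unit.
have [E EL|E EL|X [v [kv vL]]] := IH; first by apply: Lc; rewrite inE EL orbT.
  by apply: Ln; rewrite inE EL orbT.
have [Y [w [kw wF]]] := Ln F (mem_head _ _).
have [N [p [n [n0 neg]]]] := negative_combination vL wF
  (discrete_density_bound F kv) (discrete_density_bound F kw).
have [X0 _ _] := kv; have [Y0 _ _] := kw.
pose one_X : seq X -> R := fun=> 1; pose one_Y : seq Y -> R := fun=> 1.
have k1X : discrete_kernel one_X by exact: discrete_kernel1.
have k1Y : discrete_kernel one_Y by exact: discrete_kernel1.
(* The four monomials [v], [v w], [v w ^ 2] and [w], padded with constant kernels of density 1 so
   that all live on [X * Y * Y]. The coefficients become multiplicities in [l]. *)
pose T1 := tensor (tensor v one_Y) one_Y.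
pose T2 := tensor (tensor v w) one_Y.
pose T3 := tensor (tensor v w) w.
pose T4 := tensor (tensor one_X w) one_Y.
pose l := nseq (N * p ^ 2) T1 ++ nseq (2 * N * p * n) T2 ++
  nseq (N * n ^ 2) T3 ++ nseq (n ^ 2) T4.
have kl i : (i < size l)%N -> discrete_kernel (nth (fun=> 1) l i).
  rewrite /l !nth_cat !nth_nseq !size_cat !size_nseq => il.
  case: ltnP => i1; first by do 2?apply: discrete_kernel_tensor => //.
  case: ltnP => i2; first by do 2?apply: discrete_kernel_tensor => //.
  case: ltnP => i3; first by do 2?apply: discrete_kernel_tensor => //.
  case: ltnP => i4; first by do 2?apply: discrete_kernel_tensor => //.
  by move: il i1 i2 i3 i4; lia.
have l0 : (0 < size l)%N by rewrite !size_cat !size_nseq !addn_gt0 expn_gt0 n0 !orbT.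
have [Z [U [kU UE]]] := discrete_density_combination l0 kl.
exists Z, U; split=> // E EL; have [E0 e0 cE] := Lc E EL.
rewrite UE // pmulr_llt0 ?invr_gt0 ?exprn_gt0 ?ltr0n //.
rewrite !big_cat !big_nseq /= !iter_addr_0.
rewrite !discrete_density_tensor !discrete_density1 // !mulr1 mul1r.
by rewrite !addrA; have := neg E EL; rewrite !mulr_natl.
Qed.


(** * Product kernels and vertices of degree 1 *)

Definition edge_degree E (v : V) : nat := #|[set e in E | v \in e]|.

Definition product_kernel X (h : X -> R) (s : seq X) : R := \prod_(x <- s) h x.

Lemma discrete_kernel_product X (h : X -> R) :
  (0 < #|X|)%N -> (forall x, `|h x| <= 1) -> discrete_kernel (product_kernel h).
Proof.
move=> X0 h1; split=> // [s t st|s]; first exact: perm_big.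
by rewrite normr_prod prodr_ile1 // => x _; rewrite normr_ge0 h1.
Qed.

(** A vertex contributes one factor [h (phi v)] for each edge through it, so the sum over [phi]
    factors into moments of [h] of order the degree; an uncovered vertex gives the moment of order
    0. *)
Lemma discrete_density_product X (h : X -> R) E :
  discrete_density (product_kernel h) E =
  \prod_v ((\sum_x h x ^+ edge_degree E v) / #|X|%:R).
Proof.
rewrite big_split /= prodr_const exprVn /discrete_density; congr (_ / _).
rewrite bigA_distr_bigA /=; apply: eq_bigr => phi _.
rewrite /discrete_weight /product_kernel.
under eq_bigr do rewrite big_map big_enum_cond /=.
rewrite (exchange_big_dep predT) //=; apply: eq_bigr => v _.
rewrite (eq_bigl [in [set e in E | v \in e]]) ?prodr_const // => e.
by rewrite !inE andbT.
Qed.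

(** On a uniform point of ['I_3], this takes the value 1 with probability 1/3 and -1/2 with
    probability 2/3. The mean is 0, and the moment of order [d] is [(1 + 2 (-1/2) ^ d) / 3],
    positive for [d >= 2]. *)
Definition skewed (x : 'I_3) : R := if x == ord0 then 1 else - 2^-1.

Lemma skewed_moment0 : (\sum_x skewed x ^+ 0) / #|'I_3|%:R = 1.
Proof. by rewrite sumr_const divff // card_ord. Qed.

Lemma skewed_momentE d : \sum_x skewed x ^+ d = 1 + 2 * (- 2^-1) ^+ d.
Proof. by rewrite !big_ord_recl big_ord0 /skewed /= expr1n; ring. Qed.

Lemma skewed_moment1 : (\sum_x skewed x ^+ 1) / #|'I_3|%:R = 0.
Proof. by rewrite skewed_momentE expr1 mulrN divff ?subrr ?mul0r. Qed.

Lemma skewed_moment_gt0 d :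
  (1 < d)%N -> 0 < (\sum_x skewed x ^+ d) / #|'I_3|%:R.
Proof.
case: d => [|[|d]] // _; rewrite divr_gt0 ?ltr0n ?card_ord // skewed_momentE.
have : `|(- 2^-1 : R) ^+ d| <= 1.
  by rewrite normrX exprn_ile1 // normrN ger0_norm ?invr_ge0 // invf_le1 ?ler1n.
by rewrite !exprS ler_norml; lra.
Qed.

Lemma discrete_kernel_skewed : discrete_kernel (product_kernel skewed).
Proof.
apply: discrete_kernel_product => [|x]; first by rewrite card_ord.
by rewrite /skewed; case: ifP => _; rewrite ler_norml; lra.
Qed.

Lemma discrete_density_skewed_eq0 E v : edge_degree E v = 1%N ->
  discrete_density (product_kernel skewed) E = 0.
Proof.
move=> v1.
by rewrite discrete_density_product (bigD1 v) //= v1 skewed_moment1 mul0r.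
Qed.

Lemma discrete_density_skewed_gt0 E : (forall v, edge_degree E v != 1%N) ->
  0 < discrete_density (product_kernel skewed) E.
Proof.
move=> E1; rewrite discrete_density_product prodr_gt0 // => v _.
have := E1 v; case: (edge_degree E v) => [|[|d]] // _.
  by rewrite skewed_moment0.
exact: skewed_moment_gt0.
Qed.

Lemma discrete_density_skewed_ge0 E :
  0 <= discrete_density (product_kernel skewed) E.
Proof.
have [/existsP[v /eqP v1]|] := boolP [exists v, edge_degree E v == 1%N].
  by rewrite (discrete_density_skewed_eq0 v1).
by rewrite negb_exists => /forallP E1; exact/ltW/discrete_density_skewed_gt0.
Qed.

(** * Expansion around the constant kernel 1/2 *)

(** In the sum of the two expanded products, the subset [F] appears with coefficient
    [1 + (-1) ^ #|F|]. *)
Lemma prod_even_expansion E (f : {set V} -> R) :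
  \prod_(e in E) (1 + f e) + \prod_(e in E) (1 - f e) =
  2 * \sum_(F : {set {set V}} | (F \subset E) && ~~ odd #|F|)
        \prod_(e in F) f e.
Proof.
have expand (g : {set V} -> R) : \prod_(e in E) (1 + g e) =
    \sum_(F : {set {set V}} | F \subset E) \prod_(e in F) g e.
  rewrite big_mkcond /=.
  (* The summand is extended by 0 outside [E], so that in the expansion over all sets [F] those not
     contained in [E] contribute 0. *)
  have -> : \prod_e (if e \in E then 1 + g e else 1) =
      \prod_e ((if e \in E then g e else 0) + 1).
    by apply: eq_bigr => e _; case: ifP => _; rewrite ?add0r // addrC.
  rewrite bigA_distr [RHS]big_mkcond /=; apply: eq_bigr => F _.
  case: ifP => [/fintype.subsetP FE|/negbT/subsetPn[e eF eE]].
    by rewrite [RHS]big_mkcond; apply: eq_bigr => e _; case: ifP => // /FE ->.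
  by rewrite (bigD1 e) //= eF (negbTE eE) mul0r.
rewrite !expand -big_split /= mulr_sumr big_mkcondr /=.
apply: eq_bigr => F _; rewrite prodrN; case: ifPn => [|/negbNE] o.
  by rewrite -signr_odd (negbTE o) mul1r; ring.
by rewrite -signr_odd o expr1; ring.
Qed.

Lemma discrete_density_even_expansion X (U : seq X -> R) E (c : R) :
  discrete_density (fun s => (1 + c * U s) / 2) E +
  discrete_density (fun s => 1 - (1 + c * U s) / 2) E
  = 2 ^ (1 - #|E|%:Z) *
    \sum_(F : {set {set V}} | (F \subset E) && ~~ odd #|F|)
      c ^+ #|F| * discrete_density U F.
Proof.
have -> : (fun s => 1 - (1 + c * U s) / 2) = (fun s => 2^-1 * (1 - c * U s)).
  by apply/funext => s; field.
have -> : (fun s => (1 + c * U s) / 2) = (fun s => 2^-1 * (1 + c * U s)).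
  by apply/funext => s; field.
rewrite !discrete_densityZ -mulrDr.
have -> : (2 : R) ^ (1 - #|E|%:Z) = 2^-1 ^+ #|E| * 2.
  by rewrite expfzDr // mulrC exprVn -exprnN.
rewrite -mulrA; congr (_ * _).
under [in RHS]eq_bigr do rewrite -discrete_densityZ.
rewrite /discrete_density -mulrDl -mulr_suml mulrA; congr (_ / _).
rewrite -big_split /= exchange_big mulr_sumr /=.
apply: eq_bigr => phi _; rewrite /discrete_weight.
by rewrite (prod_even_expansion E (fun e => c * U [seq phi v | v <- enum e])).
Qed.

Lemma discrete_density_set0 X (U : seq X -> R) : (0 < #|X|)%N ->
  discrete_density U (finset.set0 : {set {set V}}) = 1.
Proof.
move=> X0; rewrite -(discrete_density1 (finset.set0 : {set {set V}}) X0).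
rewrite /discrete_density /discrete_weight.
by congr (_ / _); apply: eq_bigr => phi _; rewrite !big_set0.
Qed.

(** Perturb 1/2 by [c U / 2]. The term of [F0] is [- t c ^ (2 m)]; other nonempty terms with at most
    [2 m] edges do not hurt, and those with more edges are of order [c ^ (2 m + 1)], hence
    negligible for small [c]. *)
Lemma uncommon_finite X (U : seq X -> R) E F0 m :
  discrete_kernel U -> (0 < m)%N -> F0 \subset E -> #|F0| = (2 * m)%N ->
  discrete_density U F0 < 0 ->
  (forall F, F \subset E -> F != finset.set0 -> ~~ odd #|F| ->
     (#|F| <= 2 * m)%N -> discrete_density U F <= 0) ->
  exists K : seq X -> R,
    [/\ forall s t, perm_eq s t -> K s = K t, forall s, 0 <= K s <= 1 &
     discrete_density K E + discrete_density (fun s => 1 - K s) E <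
       2 ^ (1 - #|E|%:Z)].
Proof.
move=> kU m0 F0E F0m UF0 Ule; have [X0 Us Ub] := kU.
pose B : R := #|powerset E|%:R.
have B0 : 0 < B by rewrite ltr0n card_gt0; apply/set0Pn; exists F0; rewrite powersetE.
pose t := - discrete_density U F0; have t0 : 0 < t by rewrite oppr_gt0.
have t1 : t <= 1.
  by have := discrete_density_bound F0 kU; rewrite ler_norml /t; lra.
have B1 : 1 <= B by rewrite ler1n -(ltr0n R).
(* [B] bounds the number of terms, and this choice gives [B c = t / 2 < t], so the higher-order
   terms cannot offset the term of [F0]. *)
pose c : R := t / 2 / B.
have c0 : 0 < c by rewrite !divr_gt0.
have cB : B * c < t by rewrite mulrC divfK ?gt_eqF //; lra.
have c1 : c <= 1.
  by apply: le_trans (_ : B * c <= 1); [rewrite ler_peMl // ltW | lra].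
clearbody c.
exists (fun s => (1 + c * U s) / 2); split.
- by move=> s s' ss'; rewrite (Us s s').
- move=> s; have : `|c * U s| <= 1.
    by rewrite normrM mulr_ile1 // ger0_norm // ltW.
  by rewrite ler_norml; lra.
rewrite discrete_density_even_expansion -[ltRHS]mulr1 ltr_pM2l ?exprz_gt0 //.
(* The empty subgraph contributes exactly 1, the value to be undershot; the rest of the sum must be
   negative. *)
rewrite (bigD1 finset.set0) /=; last by rewrite finset.sub0set cards0.
rewrite cards0 expr0 mul1r discrete_density_set0 //.
rewrite -[ltRHS]addr0 ltrD2l.
have F00 : F0 != finset.set0 by rewrite -card_gt0 F0m muln_gt0.
rewrite (bigD1 F0) /=; last by rewrite F0E F0m oddM F00.
have bnd : \sum_(F : {set {set V}} | [&& (F \subset E) && ~~ odd #|F|,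
    F != finset.set0 & F != F0]) c ^+ #|F| * discrete_density U F
    <= B * c ^+ (2 * m).+1.
  rewrite /B mulr_natl -sumr_const big_mkcond [leRHS]big_mkcond /=.
  apply: ler_sum => F _; rewrite powersetE.
  case: ifPn => [/and3P[/andP[FE Fo] Fn _]|_]; last first.
    by case: ifP => // _; rewrite exprn_ge0 // ltW.
  rewrite FE; have [Fm|mF] := leqP #|F| (2 * m).
    apply: (@le_trans _ _ 0); last by rewrite exprn_ge0 // ltW.
    by rewrite mulr_ge0_le0 ?exprn_ge0 ?Ule // ltW.
  apply: (@le_trans _ _ (c ^+ #|F|)).
    rewrite ler_piMr ?exprn_ge0 ?(ltW c0) //.
    by apply: le_trans (ler_norm _) (discrete_density_bound F kU).
  by rewrite ler_wiXn2l // ltW.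
under eq_bigl do rewrite -andbA.
apply: (le_lt_trans (lerD (lexx _) bnd)).
have -> : B * c ^+ (2 * m).+1 = c ^+ (2 * m) * (B * c) by rewrite exprSr mulrCA.
rewrite F0m -mulrDr pmulr_rlt0 ?exprn_gt0 //.
by rewrite /t in cB; lra.
Qed.

End FiniteKernels.

Local Open Scope classical_set_scope.
Local Open Scope ring_scope.

(** * Powers of a probability measure *)

Lemma bounded_integrable d (T : measurableType d) (R : realType)
    (P : probability T R) (f : T -> R) (M : R) :
  measurable_fun setT f -> (forall x, `|f x| <= M) ->
  P.-integrable setT (EFin \o f).
Proof.
move=> mf fM; apply: measurable_bounded_integrable => //.
  by apply: le_lt_trans (probability_le1 _ measurableT) (ltry _).
exists M; split; first exact: num_real.
by move=> y My x _; exact: le_trans (fM x) (ltW My).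
Qed.

Section PowerProbability.
Context d (T : measurableType d) (R : realType) (P : probability T R).

Definition box n (A : 'I_n -> set T) : set (n.-tuple T) :=
  [set x | forall i, A i (tnth x i)].

Lemma measurable_box n (A : 'I_n -> set T) :
  (forall i, measurable (A i)) -> measurable (box A).
Proof.
move=> mA.
rewrite (_ : box A = \bigcap_(i in [set: 'I_n]) (@tnth n T ^~ i @^-1` A i)).
  apply: fin_bigcap_measurable => [|i _]; first exact: finite_finset.
  by rewrite -[X in measurable X]setTI; exact: measurable_tnth.
by apply/seteqP; split => x xA i => [_|]; [exact: xA | exact: (xA i I)].
Qed.

Lemma power_prob_box n (A : 'I_n -> set T) :
  (forall i, measurable (A i)) ->
  power_prob P n (box A) = (\prod_(i < n) P (A i))%E.
Proof.
elim: n A => [|n IH] A mA.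
  rewrite big_ord0 /= diracE mem_set //; by case.
rewrite big_ord_recl /= /distribution /pushforward.
rewrite (_ : _ @^-1` _ = A ord0 `*` box (fun i => A (lift ord0 i))).
  rewrite product_measure1E //.
    by congr (_ * _)%E; exact: IH.
  exact: measurable_box.
apply/seteqP; split=> -[t x] /=.
  move=> txA; split=> [|i /=]; first exact: (txA ord0).
  by have := txA (lift ord0 i); rewrite tnthS.
move=> [tA xA] i; case: (unliftP ord0 i) => [j|] ->.
  by rewrite tnthS; exact: xA.
by rewrite tnth0.
Qed.

(** Boxes are stable under intersection, include the whole space and generate the product
    sigma-algebra, so finite measures agreeing on them coincide. *)
Lemma power_prob_unique n (m1 m2 : {measure set (n.-tuple T) -> \bar R}) :
  (m1 setT < +oo)%E ->
  (forall A : 'I_n -> set T, (forall i, measurable (A i)) ->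
    m1 (box A) = m2 (box A)) ->
  forall B, measurable B -> m1 B = m2 B.
Proof.
move=> m1oo m12.
pose G : set (set (n.-tuple T)) :=
  [set B | exists2 A : 'I_n -> set T, (forall i, measurable (A i)) & B = box A].
have boxT : box (fun _ : 'I_n => [set: T]) = setT by apply/seteqP; split.
apply: (measure_unique G (fun=> setT)) => //.
- apply/seteqP; split.
    apply: smallest_sub; first exact: smallest_sigma_algebra.
    apply: (big_ind (fun S => S `<=` <<s G >>)) => [//|S1 S2 S1G S2G B []|i _].
    - exact: S1G.
    - exact: S2G.
    move=> _ [C mC <-]; rewrite setTI; apply: sub_sigma_algebra.
    (* The preimage of [C] under the coordinate [i] is the box whose other sides are full. *)
    exists (fun j => if j == i then C else setT).
      by move=> j; case: ifP.
    apply/seteqP; split=> [x xC j|x /(_ i)]; last by rewrite eqxx.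
    by case: ifP => // /eqP ->.
  apply: smallest_sub; first exact: sigma_algebra_measurable.
  by move=> _ [A mA ->]; exact: measurable_box.
- move=> _ _ [A mA ->] [B mB ->]; exists (fun i => A i `&` B i).
    by move=> i; exact: measurableI.
  apply/seteqP; split=> [x [xA xB] i|x xAB]; first by split.
  by split=> i; have [] := xAB i.
- by move=> _; exists (fun=> setT).
- exact: bigcup_const.
- by move=> _ [A mA ->]; exact: m12.
Qed.

Definition tuple_proj k n (phi : 'I_k -> 'I_n) (x : n.-tuple T) : k.-tuple T :=
  [tuple tnth x (phi i) | i < k].

Lemma measurable_tuple_proj k n (phi : 'I_k -> 'I_n) :
  measurable_fun setT (tuple_proj phi).
Proof.
apply/measurable_fun_tnthP => i; rewrite (_ : _ \o _ = @tnth n T ^~ (phi i)).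
  exact: measurable_tnth.
by apply/funext => x /=; rewrite tnth_mktuple.
Qed.

HB.instance Definition _ k n (phi : 'I_k -> 'I_n) :=
  isMeasurableFun.Build _ _ _ _ (tuple_proj phi) (measurable_tuple_proj phi).

(** Marginals of a power are powers. By uniqueness it suffices to treat boxes, whose preimages are
    boxes with full sides outside the image of [phi]; injectivity puts at most one constraint on
    each coordinate. *)
Lemma power_prob_proj k n (phi : 'I_k -> 'I_n) : injective phi ->
  forall B, measurable B ->
  distribution (power_prob P n) (tuple_proj phi) B = power_prob P k B.
Proof.
move=> phi_inj; apply: power_prob_unique => [|A mA].
  have := probability_setT (distribution (power_prob P n) (tuple_proj phi)).
  by move=> /= ->; rewrite ltry.
apply: etrans (esym (power_prob_box mA)).
change (power_prob P n (tuple_proj phi @^-1` box A) = (\prod_(i < k) P (A i))%E).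
(* Intersecting over all preimages of [j] avoids choosing one, and gives the full side when there is
   none. *)
pose C j : set T := [set t | forall i, phi i = j -> A i t].
have CE i : C (phi i) = A i.
  apply/seteqP; split=> [t|t At i' /phi_inj -> //]; exact.
have CT j : j \notin codom phi -> C j = setT.
  move=> jphi; apply/seteqP; split=> // t _ i ij.
  by rewrite -ij codom_f in jphi.
rewrite (_ : _ @^-1` _ = box C); last first.
  apply/seteqP; split=> x xA.
    by move=> j i <-; have := xA i; rewrite tnth_mktuple.
  by move=> i; rewrite tnth_mktuple; exact: xA.
rewrite power_prob_box => [|j]; last first.
  by have [/codomP[i ->]|/CT ->//] := boolP (j \in codom phi); rewrite CE.
rewrite (bigID [in codom phi]) /= [X in (_ * X)%E]big1 ?mule1; last first.
  by move=> j /CT ->; rewrite probability_setT.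
rewrite -big_uniq /= ?(map_inj_uniq phi_inj) ?enum_uniq //.
by rewrite /codom /image_mem big_map big_enum; apply: eq_bigr => i _; rewrite CE.
Qed.

Lemma Rintegral_proj k n (phi : 'I_k -> 'I_n) (f : k.-tuple T -> R) (M : R) :
  injective phi -> measurable_fun setT f -> (forall x, `|f x| <= M) ->
  \int[power_prob P n]_x f (tuple_proj phi x) = \int[power_prob P k]_x f x.
Proof.
move=> phi_inj mf fM; rewrite /Rintegral; congr fine.
rewrite [RHS](eq_measure_integral
  (distribution (power_prob P n) (tuple_proj phi))); last first.
  by move=> A mA _; apply/esym; exact: power_prob_proj.
rewrite integral_pushforward //; first exact/measurable_EFinP.
apply: (@bounded_integrable _ _ _ _ (fun x => f (tuple_proj phi x)) M) => //.
exact: measurableT_comp (measurable_tuple_proj phi).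
Qed.

End PowerProbability.

(** * Homomorphism densities on the unit cube *)

Section UnitCube.
Variable R : realType.
Local Notation RT := (measurableTypeR R).
Local Notation mu := (unit_cube_prob R).

Lemma unit_cubeE n :
  @unit_cube R n = box (T := RT) (fun=> (`[0 : R, 1]%classic : set R)).
Proof.
apply/seteqP; split=> x xI i; have := xI i; first by rewrite /= in_itv.
by rewrite /= in_itv.
Qed.

Lemma measurable_unit_cube n : measurable (@unit_cube R n).
Proof. by rewrite unit_cubeE; apply: measurable_box => i; exact: measurable_itv. Qed.

Lemma unit_cube_prob1 n : mu n (@unit_cube R n) = 1%E.
Proof.
rewrite unit_cubeE; apply: etrans (power_prob_box _ _) _ => [i|].
  exact: measurable_itv.
by apply: big1 => i _; exact: integral_uniform_pdf1.
Qed.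

(** The cube has full measure, so its complement is negligible. *)
Lemma Rintegral_unit_cube n (f : n.-tuple RT -> R) (M : R) :
  measurable_fun setT f -> (forall x, `|f x| <= M) ->
  \int[mu n]_(x in @unit_cube R n) f x = \int[mu n]_x f x.
Proof.
move=> mf fM; rewrite /Rintegral; congr fine.
have mC := @measurable_unit_cube n.
rewrite [RHS](negligible_integral (measurableC mC)) //.
- by rewrite setTD setCK.
- exact: bounded_integrable mf fM.
- apply: etrans (probability_setC (mu n) mC) _.
  by rewrite unit_cube_prob1 subee.
Qed.

Section PaddedTuples.
Variable r : nat.

(** A total conversion from lists to [r]-tuples; the padding value 0 lies in [[0, 1]], so that
    points never leave the cube. *)
Definition padded_tuple (s : seq R) : r.-tuple RT :=
  [tuple nth (0 : R) s i | i < r].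

Lemma tval_padded_tuple s : size s = r -> tval (padded_tuple s) = s.
Proof.
move=> sr; apply: (@eq_from_nth _ 0) => [|i]; first by rewrite size_tuple.
rewrite size_tuple => ir.
by rewrite -[i]/(nat_of_ord (Ordinal ir)) -tnth_nth tnth_mktuple.
Qed.

Lemma padded_tuple_in_cube s :
  (forall y, y \in s -> 0 <= y <= 1) -> unit_cube (padded_tuple s).
Proof.
move=> s01 i; rewrite tnth_mktuple; have [ie|ei] := ltnP i (size s).
  by apply: s01; exact: mem_nth.
by rewrite nth_default // lexx ler01.
Qed.

Lemma measurable_padded_tuple d (T : measurableType d) (V : eqType) (s : seq V)
    (f : V -> T -> RT) :
  (forall v, measurable_fun setT (f v)) ->
  measurable_fun setT (fun x => padded_tuple [seq (f v x : R) | v <- s]).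
Proof.
move=> mf; apply/measurable_fun_tnthP => i.
case: s => [|v0 s].
  apply: (eq_measurable_fun (cst (0 : R))) => [x _ /=|]; last exact: measurable_cst.
  by rewrite tnth_mktuple nth_nil.
have [is_|si] := ltnP i (size (v0 :: s)); last first.
  apply: (eq_measurable_fun (cst (0 : R))) => [x _|]; last exact: measurable_cst.
  by rewrite [RHS]tnth_mktuple nth_default ?size_map.
apply: (eq_measurable_fun (f (nth v0 (v0 :: s) i))) => [x _|]; last exact: mf.
by rewrite [RHS]tnth_mktuple (nth_map v0).
Qed.

End PaddedTuples.

Section Density.
Variables (V : finType) (r : nat).
Implicit Types (G : rhypergraph V r) (W : r.-tuple RT -> R).

Definition sample_point n (psi : V -> 'I_n) (x : n.-tuple RT) (e : {set V}) :=
  padded_tuple r [seq (tnth x (psi v) : R) | v <- enum e].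

Lemma measurable_sample_point n (psi : V -> 'I_n) e :
  measurable_fun setT (fun x => sample_point psi x e).
Proof. by apply: measurable_padded_tuple => v; exact: measurable_tnth. Qed.

Lemma sample_point_in_cube n (psi : V -> 'I_n) (x : n.-tuple RT) e :
  unit_cube x -> unit_cube (sample_point psi x e).
Proof.
by move=> x01; apply: padded_tuple_in_cube => y /mapP[v _ ->]; exact: x01.
Qed.

Lemma edge_point_sample G n (psi : V -> 'I_n) (x : n.-tuple RT) e :
  e \in eset G ->
  edge_point (tuple_proj (fun i : 'I_#|vset G| => psi (enum_val i)) x) e
  = sample_point psi x e.
Proof.
move=> eG; have /forall_inP/(_ e eG)/andP[/fintype.subsetP eV _] := edge_uniform G.
apply: eq_from_tnth => i; rewrite !tnth_mktuple; congr nth.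
apply/eq_in_map => v; rewrite mem_enum => /eV vG.
have iv : (index v (enum (vset G)) < #|vset G|)%N.
  by rewrite cardE index_mem mem_enum.
rewrite /vcoord -[index _ _]/(nat_of_ord (Ordinal iv)) -tnth_nth tnth_mktuple.
by rewrite (enum_val_nth v) nth_index // mem_enum.
Qed.

Lemma measurable_edge_point G e :
  measurable_fun setT (fun x => @edge_point R V r G x e).
Proof.
apply: (@measurable_padded_tuple r _ _ _ (enum e)
  (fun v x => @vcoord R V r G x v)) => v.
have [jn|nj] := ltnP (index v (enum (vset G))) #|vset G|.
  apply: eq_measurable_fun (measurable_tnth (Ordinal jn)) => x _.
  by rewrite (tnth_nth (0 : R)).
apply: (eq_measurable_fun (cst (0 : R))) => [x _|]; last exact: measurable_cst.
by rewrite /vcoord nth_default ?size_tuple.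
Qed.

Lemma edge_point_in_cube G x e :
  unit_cube x -> unit_cube (@edge_point R V r G x e).
Proof.
move=> x01; apply: padded_tuple_in_cube => y /mapP[v _ ->]; rewrite /vcoord.
have [jn|nj] := ltnP (index v (enum (vset G))) #|vset G|.
  by rewrite -[index _ _]/(nat_of_ord (Ordinal jn)) -tnth_nth; exact: x01.
by rewrite nth_default ?size_tuple // lexx ler01.
Qed.

Lemma measurable_prod_kernel (I : finType) (A : {set I}) n
    (p : n.-tuple RT -> I -> r.-tuple RT) W :
  measurable_fun setT W -> (forall i, measurable_fun setT (p ^~ i)) ->
  measurable_fun setT (fun x => \prod_(i in A) W (p x i)).
Proof.
move=> mW mp; rewrite (_ : (fun x => _) = fun x => \prod_(i <- enum A) W (p x i)).
  by apply: measurable_prod => i _; exact: measurableT_comp.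
by apply/funext => x; rewrite big_enum.
Qed.

Lemma norm_prod_kernel (I : finType) (A : {set I}) (f : I -> R) :
  (forall i, `|f i| <= 1) -> `|\prod_(i in A) f i| <= 1.
Proof. by move=> f1; rewrite normr_prod prodr_ile1 // => i _; rewrite normr_ge0 f1. Qed.

(** A kernel is only controlled on the cube; its extension by 0 is measurable and bounded
    everywhere, as the integration lemmas demand. *)
Lemma extend_kernel W (mW : measurable_fun (@unit_cube R r) W)
    (W1 : forall x, unit_cube x -> `|W x| <= 1) :
  exists W' : r.-tuple RT -> R,
    [/\ measurable_fun setT W', forall x, `|W' x| <= 1 &
        forall x, unit_cube x -> W' x = W x].
Proof.
exists (W \_ (@unit_cube R r)); split.
- by apply/(measurable_restrictT _ (@measurable_unit_cube r)).
- move=> x; rewrite patchE; case: ifPn => [/set_mem/W1//|_].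
  by rewrite normr0.
- by move=> x xC; rewrite patchE mem_set.
Qed.

(** When [psi] separates the vertices of [G], the coordinates that it selects are again independent
    and uniform, so the density can be computed in any cube receiving the vertices in this way. *)
Lemma hom_density_sample G W n (psi : V -> 'I_n) :
  measurable_fun (@unit_cube R r) W -> (forall x, unit_cube x -> `|W x| <= 1) ->
  {in vset G &, injective psi} ->
  hom_density G W =
  \int[mu n]_(x in @unit_cube R n)
    \prod_(e in eset G) W (sample_point psi x e).
Proof.
move=> mW W1 psi_inj; have [W' [mW' W'1 W'E]] := extend_kernel mW W1.
pose g (x : #|vset G|.-tuple RT) := \prod_(e in eset G) W' (edge_point x e).
have mg : measurable_fun setT g.
  by apply: measurable_prod_kernel => // e; exact: measurable_edge_point.
have g1 x : `|g x| <= 1 by exact: norm_prod_kernel.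
pose phi (i : 'I_#|vset G|) := psi (enum_val i).
have phi_inj : injective phi.
  by move=> i j /psi_inj ij; apply: enum_val_inj; apply: ij; exact: enum_valP.
transitivity (\int[mu #|vset G|]_(x in @unit_cube R #|vset G|) g x).
  apply: eq_Rintegral => x /set_mem xC; apply: eq_bigr => e _.
  by rewrite W'E //; exact: edge_point_in_cube.
rewrite (Rintegral_unit_cube mg g1) -(Rintegral_proj _ phi_inj mg g1).
have mgp : measurable_fun setT (fun x => g (tuple_proj phi x)).
  exact: measurableT_comp (measurable_tuple_proj phi).
rewrite -(Rintegral_unit_cube mgp (fun x => g1 _)).
apply: eq_Rintegral => x /set_mem xC; apply: eq_bigr => e eG.
by rewrite edge_point_sample // W'E //; exact: sample_point_in_cube.
Qed.

End Density.
End UnitCube.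

(** * Sampling *)

Lemma Rintegral_sum d (T : measurableType d) (R : realType)
    (m : {measure set T -> \bar R}) (D : set T) (I : Type) (s : seq I)
    (f : I -> T -> R) :
  measurable D -> (forall i, m.-integrable D (EFin \o f i)) ->
  \int[m]_(x in D) (\sum_(i <- s) f i x) = \sum_(i <- s) \int[m]_(x in D) f i x.
Proof.
move=> mD fi; rewrite /Rintegral.
under eq_integral do rewrite -sumEFin.
rewrite (integral_sum mD fi) -sum_fine => [//|i _]; exact: integrable_fin_num.
Qed.

(** Bounds by [k ^ 2 / n] the proportion of non-injective maps among all maps from [k] points to [n]
    points; the factor [n] clears the denominator. *)
Lemma expn_le_ffact n k : (n * n ^ k <= n * n ^_ k + k ^ 2 * n ^ k)%N.
Proof.
elim: k => [|k IH]; first by rewrite ffactn0 expn0 leq_addr.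
have le_ffact : (n ^_ k <= n ^ k)%N.
  elim: k {IH} => // k IH; rewrite ffactnSr expnSr.
  by apply: leq_mul => //; exact: leq_subr.
rewrite ffactnSr expnSr.
have h : (n <= (n - k) + k)%N by lia.
move: (n - k)%N (n ^_ k) (n ^ k)%N IH le_ffact h => a b c IH bc nak.
have h1 : (n * c * n <= (n * b + k ^ 2 * c) * n)%N by rewrite leq_mul2r IH orbT.
have h2 : (n * b * n <= n * b * (a + k))%N by rewrite leq_mul2l nak orbT.
have h3 : (n * k * b <= n * k * c)%N by rewrite leq_mul2l bc orbT.
have h4 : (k * (c * n) + k ^ 2 * (c * n) <= k.+1 ^ 2 * (c * n))%N.
  by rewrite -mulnDl leq_mul2r; apply/orP; right; rewrite !expnS !expn0; nia.
nia.
Qed.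

Lemma ffact_dominates (R : realType) k (t : R) : t < 0 ->
  exists2 n : nat, (0 < n)%N &
    (n ^_ k)%:R * t + ((n ^ k)%:R - (n ^_ k)%:R) < 0.
Proof.
move=> t0; pose c := (k ^ 2)%:R * (1 - t) / - t.
have nt0 : 0 < - t by rewrite oppr_gt0.
exists (Num.truncn c).+1 => //; set n := _.+1.
have cn : c < n%:R := truncnS_gt c.
have n0 : 0 < n%:R :> R by rewrite ltr0n.
have nk0 : 0 < (n ^ k)%:R :> R by rewrite ltr0n expn_gt0.
have h : n%:R * (n ^ k)%:R <= n%:R * (n ^_ k)%:R + (k ^ 2)%:R * (n ^ k)%:R :> R.
  by rewrite -!natrM -natrD ler_nat expn_le_ffact.
rewrite /c ltr_pdivrMr // in cn; clearbody n; clear c.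
move: (n ^_ k)%:R (n ^ k)%:R n%:R (k ^ 2)%:R n0 nk0 h cn => b a N K N0 a0 h cn.
have h2 : (1 - t) * (N * (a - b)) <= (1 - t) * (K * a) by rewrite ler_pM2l; lra.
have h3 : K * (1 - t) * a < N * - t * a by rewrite ltr_pM2r.
have : N * (b * t + (a - b)) < 0 by lra.
by rewrite pmulr_rlt0.
Qed.

Section Sampling.
Variables (R : realType) (V : finType) (r : nat).
Local Notation RT := (measurableTypeR R).
Local Notation mu := (unit_cube_prob R).

Lemma discrete_kernel_sample (W : r.-tuple RT -> R) n (x : n.-tuple RT) :
  (0 < n)%N -> symmetric_kernel (-1) 1 W -> unit_cube x ->
  discrete_kernel (fun s : seq 'I_n => if size s == r
    then W (padded_tuple r [seq (tnth x j : R) | j <- s]) else 0).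
Proof.
move=> n0 [_ Wsym W1] x01.
have in_cube (s : seq 'I_n) :
    unit_cube (padded_tuple r [seq (tnth x j : R) | j <- s]).
  by apply: padded_tuple_in_cube => y /mapP[j _ ->]; exact: x01.
split=> [|s t st|s]; first by rewrite card_ord.
- rewrite (perm_size st); case: eqP => // tr.
  have sr : size s = r by rewrite (perm_size st).
  set y := padded_tuple _ _; set z := padded_tuple _ _.
  have /tuple_permP[p yz] : perm_eq y z.
    by rewrite !tval_padded_tuple ?size_map // perm_map.
  have -> : y = [tuple tnth z (p i) | i < r] by exact: val_inj.
  by rewrite Wsym //; exact: in_cube.
- case: ifP => _; last by rewrite normr0.
  by rewrite ler_norml; exact: W1.
Qed.

(** First moment method: for [n] uniform points, the expected sum over all maps from [V] to the
    points is at most [(n ^_ #|V|) t + (n ^ #|V| - n ^_ #|V|)] with [t] the negative density, and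
    this is negative for a suitable [n]. *)
Lemma nonpositive_finite (G : rhypergraph V r) : ~ positive_hypergraph R G ->
  exists (X : finType) (U : seq X -> R),
    discrete_kernel U /\ discrete_density U (eset G) < 0.
Proof.
move=> /existsNP[W] /not_implyP[symW] /negP; rewrite -ltNge => t0.
have [mW _ W11] := symW.
have W1 x : unit_cube x -> `|W x| <= 1 by move=> /W11; rewrite ler_norml.
have [W' [mW' W'1 W'E]] := extend_kernel mW W1.
have [n n0 neg] := ffact_dominates #|V| t0.
pose h (phi : {ffun V -> 'I_n}) (x : n.-tuple RT) : R :=
  \prod_(e in eset G) W' (sample_point r phi x e).
have mh phi : measurable_fun setT (h phi).
  by apply: measurable_prod_kernel => // e; exact: measurable_sample_point.
have h1 phi x : `|h phi x| <= 1 by exact: norm_prod_kernel.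
have mC := @measurable_unit_cube R n.
have ih phi : (mu n).-integrable (@unit_cube R n) (EFin \o h phi).
  apply: integrableS (bounded_integrable (mu n) (mh phi) (h1 phi)) => //.
(* If the sum is negative at some sample [x], then [W] read at the points of [x] is the required
   kernel; otherwise the integral of the sum is nonnegative. *)
have [[x [x01 xneg]]|nox] :=
  pselect (exists x, unit_cube x /\ \sum_phi h phi x < 0).
  exists 'I_n; eexists; split; first exact: discrete_kernel_sample n0 symW x01.
  rewrite /discrete_density card_ord pmulr_llt0 ?invr_gt0 ?exprn_gt0 ?ltr0n //.
  move: xneg; congr (_ < _); apply: eq_bigr => phi _; apply: eq_bigr => e eG.
  have /forall_inP/(_ e eG)/andP[_ /eqP er] := edge_uniform G.
  rewrite size_map -cardE er eqxx W'E; last exact: sample_point_in_cube.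
  by congr W; apply: eq_from_tnth => i; rewrite !tnth_mktuple -map_comp.
have : 0 <= \int[mu n]_(x in @unit_cube R n) (\sum_phi h phi x).
  apply: Rintegral_ge0 => x x01; rewrite leNgt; apply/negP => xneg.
  by apply: nox; exists x.
rewrite Rintegral_sum // leNgt; move/negP; case.
apply: le_lt_trans neg.
(* An injective [phi] integrates to the density of [G], any other to at most 1. *)
rewrite (bigID (fun phi : {ffun V -> 'I_n} => injectiveb phi)) /=.
pose S : {set {ffun V -> 'I_n}} :=
  [set phi : {ffun V -> 'I_n} | injectiveb phi]%SET.
have cardS : #|S| = (n ^_ #|V|)%N by rewrite card_inj_ffuns card_ord.
apply: lerD.
  rewrite -cardS mulr_natl -sumr_const (eq_bigl [in S]) => [|phi]; last by rewrite inE.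
  apply: ler_sum => phi; rewrite inE => /injectiveP phi_inj.
  rewrite (@hom_density_sample R V r G W n phi mW W1 (in2W phi_inj)).
  rewrite le_eqVlt; apply/orP; left; apply/eqP; apply: eq_Rintegral => x /set_mem x01.
  by apply: eq_bigr => e _; rewrite W'E //; exact: sample_point_in_cube.
have -> : (n ^ #|V|)%:R - (n ^_ #|V|)%:R = #|~: S|%:R :> R.
  rewrite -cardS; have := cardsC S; rewrite card_ffun card_ord => <-.
  by rewrite natrD addrAC subrr add0r.
rewrite -sumr_const (eq_bigl [in ~: S]) => [|phi]; last by rewrite !inE.
apply: ler_sum => phi _.
have -> : 1 = \int[mu n]_(x in @unit_cube R n) (1 : R).
  rewrite Rintegral_cst // mul1r.
  exact: esym (congr1 fine (unit_cube_prob1 R n)).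
apply: le_Rintegral => //; last by move=> x _; apply: le_trans (ler_norm _) (h1 _ _).
have := bounded_integrable (mu n) (f := cst (1 : R)) (M := 1) (measurable_cst _) _.
by move=> /(_ _)/integrableS; apply => // x; rewrite normr1.
Qed.

End Sampling.

(** * Step kernels *)

Section Steps.
Variables (R : realType) (X : finType).
Hypothesis X0 : (0 < #|X|)%N.
Local Notation RT := (measurableTypeR R).
Local Notation mu := (unit_cube_prob R).
Local Notation N := #|X|.

Lemma color_subproof (t : R) : (minn (Num.truncn (N%:R * t)) N.-1 < N)%N.
Proof. by rewrite gtn_min ltn_predL X0 orbT. Qed.

(** Cuts [[0, 1]] into [N] cells of equal length; the [minn] sends [t = 1], where [N t] has integer
    part [N], to the last cell. *)
Definition color (t : R) : X := enum_val (Ordinal (color_subproof t)).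

(* The last interval is closed, so that the intervals cover [0, 1]. *)
Definition color_itv (j : X) : interval R :=
  let i := enum_rank j in
  Interval (BLeft (i%:R / N%:R)) (BSide (i.+1 != N) (i.+1%:R / N%:R)).

Lemma colorP (t : R) j : 0 <= t <= 1 -> (color t == j) = (t \in color_itv j).
Proof.
move=> /andP[t0 t1].
have N0 : 0 < N%:R :> R by rewrite ltr0n.
rewrite -(inj_eq enum_rank_inj) /color enum_valK -val_eqE /=.
rewrite /color_itv itv_boundlr bnd_simp /=.
set i := enum_rank j; have iN : (i < N)%N by [].
have Nt0 : 0 <= N%:R * t by rewrite mulr_ge0 // ltW.
have tN : N%:R * t <= N%:R by rewrite ler_piMr // ltW.
rewrite ler_pdivrMr // [t * _]mulrC -truncn_ge_nat //.
have last_cell (k a M : nat) : a.+1 = M -> (minn k M.-1 == a) = (a <= k)%N by lia.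
have inner_cell (k a M : nat) : (a < M)%N -> a.+1 != M ->
  (minn k M.-1 == a) = (a <= k)%N && (k < a.+1)%N by lia.
have [iE|iE] /= := eqVneq i.+1 N.
  rewrite bnd_simp ler_pdivlMr // [t * _]mulrC iE tN andbT.
  exact: last_cell.
rewrite bnd_simp ltr_pdivlMr // [t * _]mulrC -truncn_lt_nat //.
exact: inner_cell.
Qed.

Lemma color_itv_sub j : [set` color_itv j] `<=` (`[0, 1] : set R).
Proof.
have N0 : 0 < N%:R :> R by rewrite ltr0n.
move=> t /=; rewrite !itv_boundlr !bnd_simp => /andP[/= jt tj].
apply/andP; split.
  by apply: le_trans jt; rewrite divr_ge0 // ltW.
have : t <= (enum_rank j).+1%:R / N%:R.
  by move: tj; case: (_ != _); rewrite bnd_simp // => /ltW.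
move=> /le_trans; apply; rewrite ler_pdivrMr // mul1r ler_nat.
exact: ltn_ord.
Qed.

Lemma uniform_color_itv j :
  uniform_prob (@ltr01 R) ([set` color_itv j] : set R) = (N%:R^-1 : R)%:E.
Proof.
have N0 : 0 < N%:R :> R by rewrite ltr0n.
have sub01 := @color_itv_sub j.
rewrite /uniform_prob integral_uniform_pdf setIidl //.
rewrite (eq_integral (cst (1 : R)%:E)); last first.
  move=> t /set_mem /sub01 /=; rewrite in_itv /= /uniform_pdf => ->.
  by rewrite subr0 invr1.
rewrite integral_cst //= mul1e lebesgue_measure_itv /= lte_fin.
rewrite ltr_pM2r ?invr_gt0 // ltr_nat ltnSn -EFinB -mulrBl -natr1.
by rewrite addrAC subrr add0r mul1r.
Qed.

Definition color_box n (phi : {ffun 'I_n -> X}) : set (n.-tuple RT) :=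
  box (fun i => ([set` color_itv (phi i)] : set R)).

Lemma measurable_color_box n (phi : {ffun 'I_n -> X}) :
  measurable (color_box phi).
Proof. by apply: measurable_box => i; exact: measurable_itv. Qed.

Lemma step_functionE n (c : {ffun 'I_n -> X} -> R) (x : n.-tuple RT) :
  unit_cube x ->
  c [ffun i => color (tnth x i)] = \sum_phi c phi * \1_(color_box phi) x.
Proof.
move=> x01; pose f := [ffun i => color (tnth x i)].
have boxE phi : (x \in color_box phi) = (phi == f).
  apply/idP/eqP => [/set_mem xb|->].
    apply/ffunP => i; rewrite ffunE; apply/esym/eqP.
    by rewrite colorP //; exact: xb.
  by apply/mem_set => i /=; rewrite ffunE -colorP.
rewrite (bigD1 f) //= big1 => [|phi pf].
  by rewrite indicE boxE eqxx mulr1 addr0.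
by rewrite indicE boxE (negbTE pf) mulr0.
Qed.

Lemma measurable_step n (c : {ffun 'I_n -> X} -> R) :
  measurable_fun (@unit_cube R n)
    (fun x : n.-tuple RT => c [ffun i => color (tnth x i)]).
Proof.
apply: (eq_measurable_fun (fun x => \sum_phi c phi * \1_(color_box phi) x)).
  by move=> x /set_mem x01; rewrite step_functionE.
apply: measurable_funTS; apply: measurable_sum => phi.
apply: measurable_funM; first exact: measurable_cst.
by apply: measurable_indic; exact: measurable_color_box.
Qed.

Lemma Rintegral_step n (c : {ffun 'I_n -> X} -> R) :
  \int[mu n]_(x in @unit_cube R n) c [ffun i => color (tnth x i)] =
  (\sum_phi c phi) / N%:R ^+ n.
Proof.
have mC := @measurable_unit_cube R n.
transitivity (\int[mu n]_(x in @unit_cube R n)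
    (\sum_phi c phi * \1_(color_box phi) x)).
  by apply: eq_Rintegral => x /set_mem x01; rewrite step_functionE.
have iind (phi : {ffun 'I_n -> X}) :
    (mu n).-integrable (@unit_cube R n) (EFin \o \1_(color_box phi)).
  apply: integrableS (bounded_integrable (mu n) (M := 1) _ _) => //.
    by apply: measurable_indic; exact: measurable_color_box.
  by move=> x; rewrite indicE; case: (_ \in _); rewrite ?normr1 ?normr0.
rewrite Rintegral_sum // => [|phi]; last first.
  exact: (integrableZl mC (c phi) (iind phi)).
rewrite mulr_suml; apply: eq_bigr => phi _.
rewrite RintegralZl //; congr (_ * _).
rewrite /Rintegral integral_indic //; last exact: measurable_color_box.
rewrite setIidl; last first.
  move=> x xb i; have := @color_itv_sub (phi i) (tnth x i) (xb i).
  by rewrite /= in_itv.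
apply: etrans (congr1 fine (power_prob_box _ _)) _ => [i|]; first exact: measurable_itv.
transitivity (fine (\prod_(i < n) (N%:R^-1 : R)%:E)%E).
  by congr fine; apply: eq_bigr => i _; exact: uniform_color_itv.
by rewrite prodEFin /= prodr_const card_ord exprVn.
Qed.

End Steps.

Section StepKernel.
Variables (R : realType) (X : finType) (V : finType) (r : nat).
Hypothesis X0 : (0 < #|X|)%N.
Local Notation RT := (measurableTypeR R).
Local Notation mu := (unit_cube_prob R).

Definition step_kernel (K : seq X -> R) (x : r.-tuple RT) : R :=
  K [seq color X0 (t : R) | t <- x].

Lemma measurable_step_kernel (K : seq X -> R) :
  measurable_fun (@unit_cube R r) (step_kernel K).
Proof.
pose c (phi : {ffun 'I_r -> X}) := K [seq phi i | i <- enum 'I_r].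
apply: eq_measurable_fun (measurable_step X0 c) => x _.
rewrite /step_kernel /c; congr K.
rewrite -[in RHS](map_tnth_enum x) -[RHS]map_comp; apply: eq_map => i /=.
by rewrite ffunE.
Qed.

Lemma symmetric_step_kernel (K : seq X -> R) (a b : R) :
  (forall s t, perm_eq s t -> K s = K t) -> (forall s, a <= K s <= b) ->
  symmetric_kernel a b (step_kernel K).
Proof.
move=> Ksym Kab; split=> [|s x _|x _]; first exact: measurable_step_kernel.
  apply: Ksym; apply: perm_map; apply/tuple_permP.
  by exists s.
exact: Kab.
Qed.

(** Sampling one coordinate for every element of [V], covered or not, matches the average over all
    maps from [V] in [discrete_density]; each box of colors has measure [#|X| ^- #|V|]. *)
Lemma hom_density_step (G : rhypergraph V r) (K : seq X -> R) :
  (forall s, `|K s| <= 1) ->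
  hom_density G (step_kernel K) = discrete_density K (eset G).
Proof.
move=> K1.
rewrite (@hom_density_sample R V r G _ #|V| enum_rank (measurable_step_kernel K));
  [|by move=> x _; exact: K1|by move=> u v _ _; exact: enum_rank_inj].
pose c (phi : {ffun 'I_#|V| -> X}) :=
  \prod_(e in eset G) K [seq phi (enum_rank v) | v <- enum e].
transitivity (\int[mu #|V|]_(x in @unit_cube R #|V|)
    c [ffun i => color X0 (tnth x i)]).
  apply: eq_Rintegral => x _; apply: eq_bigr => e eG; congr K.
  have /forall_inP/(_ e eG)/andP[_ /eqP er] := edge_uniform G.
  rewrite tval_padded_tuple ?size_map -?cardE // -map_comp.
  by apply: eq_map => v /=; rewrite ffunE.
rewrite Rintegral_step /discrete_density; congr (_ / _).
rewrite (reindex (fun phi : {ffun V -> X} => [ffun i => phi (enum_val i)])) /=.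
  apply: eq_bigr => phi _; apply: eq_bigr => e _; congr K.
  by apply: eq_map => v; rewrite ffunE enum_rankK.
exists (fun psi : {ffun 'I_#|V| -> X} => [ffun v => psi (enum_rank v)]) => phi _.
  by apply/ffunP => v; rewrite !ffunE enum_rankK.
by apply/ffunP => v; rewrite !ffunE enum_valK.
Qed.

End StepKernel.

(** * Degrees in 2-connected hypergraphs *)

Section TwoConnected.
Variables (V : finType) (r : nat).

Lemma connect_isolated (E : {set {set V}}) u v :
  (forall e w, e \in E -> v \in e -> w \in e -> w = v) ->
  connect (Defs.adjacent E) v u -> u = v.
Proof.
move=> iso /connectP[p]; elim: p => [|w p IH] /=; first by move=> _ ->.
by move=> /andP[/existsP[e /and3P[eE ve we]]]; rewrite (iso e w).
Qed.

(** Let [e] be the only edge at [v]. If [r >= 3], deleting [e] isolates [v] from the other vertices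
    of [e]. If [r = 2], deleting the other end [w] of [e] isolates [v] from a vertex [u] of another
    edge. *)
Lemma two_connected_degree (G : rhypergraph V r) :
  (2 <= r)%N -> vset G = finset.cover (eset G) -> two_connected G ->
  (1 < #|eset G|)%N -> forall v, edge_degree (eset G) v != 1%N.
Proof.
move=> r2 GV [_ cv ce] G2 v; apply/negP => /eqP v1.
have /eqP/cards1P[e eE] := v1.
have : e \in [set e in eset G | v \in e]%SET by rewrite eE finset.set11.
rewrite finset.inE => /andP[eG ve].
have only f : f \in eset G -> v \in f -> f = e.
  move=> fG vf; have : f \in [set e in eset G | v \in e]%SET.
    by rewrite finset.inE fG.
  by rewrite eE => /set1P.
have card_edge f : f \in eset G -> #|f| = r.
  by move=> fG; have /forall_inP/(_ f fG)/andP[_ /eqP] := edge_uniform G.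
have sub f : f \in eset G -> f \subset vset G.
  by move=> fG; have /forall_inP/(_ f fG)/andP[] := edge_uniform G.
have other f x : f \in eset G -> exists2 u, u \in f & u != x.
  move=> fG; have : (0 < #|f :\ x|)%N.
    by have := cardsD1 x f; rewrite card_edge //; case: (x \in f) => /=; lia.
  by move=> /card_gt0P[u]; rewrite !finset.inE => /andP[ux uf]; exists u.
have [r3|r3] := leqP 3 r.
  have [u ue uv] := other e v eG.
  have /forall_inP/(_ v (fintype.subsetP (sub e eG) v ve)) := ce r3 e eG.
  move=> /forall_inP/(_ u (fintype.subsetP (sub e eG) u ue)).
  move=> /connect_isolated uvE; case/eqP: uv; apply: uvE => f w.
  by rewrite !finset.inE => /andP[fe fG] vf; rewrite (only f) ?eqxx in fe.
have [w we wv] := other e v eG.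
have [f fG fe] : exists2 f, f \in eset G & f != e.
  have : (0 < #|eset G :\ e|)%N by have := cardsD1 e (eset G); rewrite eG; lia.
  by move=> /card_gt0P[f]; rewrite !finset.inE => /andP[fe fG]; exists f.
have [u uf uw] := other f w fG.
have uv : u != v by apply: contraNneq fe => uv; rewrite (only f) // -uv.
have wG : w \in vset G by apply: (fintype.subsetP (sub e eG)).
have /forall_inP/(_ v) := cv w wG.
rewrite finset.in_setD1 eq_sym wv (fintype.subsetP (sub e eG)) // => /(_ isT).
move=> /forall_inP/(_ u); rewrite finset.in_setD1 uw (fintype.subsetP (sub f fG)) //.
move=> /(_ isT)/connect_isolated uvE; case/eqP: uv; apply: uvE => g z.
move=> /imsetP[g' g'G ->]; rewrite !finset.inE => /andP[_ /(only _ g'G) ->].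
move=> /andP[zw ze]; apply/eqP/negPn/negP => zv.
(* Otherwise [z] would be a third vertex of [e], while [r = 2]. *)
have : ([set v; w] :|: [set z] \subset e)%SET.
  by apply/fintype.subsetP => y; rewrite !finset.inE => /orP[/orP[]|] /eqP ->.
move=> /subset_leq_card; rewrite (card_edge e eG) finset.setUC cardsU1 cards2.
by rewrite !finset.inE (negbTE zv) (negbTE zw) eq_sym wv /=; lia.
Qed.

End TwoConnected.

(** * From finite kernels back to the hypergraph *)

Lemma common_step_kernel (R : realType) (V : finType) (r : nat) (X : finType)
    (H : rhypergraph V r) (K : seq X -> R) :
  (0 < #|X|)%N -> (forall s t, perm_eq s t -> K s = K t) ->
  (forall s, 0 <= K s <= 1) -> common_hypergraph R H ->
  2 ^ (1 - #|eset H|%:Z) <=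
  discrete_density K (eset H) + discrete_density (fun s => 1 - K s) (eset H).
Proof.
move=> X0 Ksym K01 /(_ (step_kernel X0 K) (symmetric_step_kernel r X0 Ksym K01)).
have K1 s : `|K s| <= 1 by have /andP[K0 ?] := K01 s; rewrite ger0_norm.
have K'1 s : `|1 - K s| <= 1.
  by have /andP[K0 ?] := K01 s; rewrite ger0_norm ?subr_ge0 // gerBl.
by rewrite (hom_density_step X0 H K1) (hom_density_step X0 H K'1).
Qed.

Lemma edge_neq0 (V : finType) (r : nat) (F : rhypergraph V r) e :
  (0 < r)%N -> e \in eset F -> e != finset.set0.
Proof.
move=> r0 eF; rewrite -card_gt0.
by have /forall_inP/(_ e eF)/andP[_ /eqP ->] := edge_uniform F.
Qed.

(** The kernel is chosen before [F]: as [V] is finite, there are finitely many connected edge sets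
    with a negative density for some kernel, and one kernel serves them all. The skewed factor then
    kills the edge sets with a vertex of degree 1. *)
Lemma negative_kernel (R : realType) (V : finType) (r : nat) : (0 < r)%N ->
  exists (X : finType) (U : seq X -> R), discrete_kernel U /\
    forall F : rhypergraph V r,
      ((exists v, edge_degree (eset F) v = 1%N) ->
       discrete_density U (eset F) = 0) /\
      (vset F = finset.cover (eset F) -> (0 < #|eset F|)%N ->
       ~ positive_hypergraph R F -> two_connected F ->
       discrete_density U (eset F) <= 0 /\
       ((forall v, edge_degree (eset F) v != 1%N) ->
        discrete_density U (eset F) < 0)).
Proof.
move=> r0.
pose good (E : {set {set V}}) := [/\ E != finset.set0,
  forall e, e \in E -> e != finset.set0,
  connected_hypergraph (finset.cover E) E &
  exists (X : finType) (U : seq X -> R),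
    discrete_kernel U /\ discrete_density U E < 0].
pose L := [seq E <- enum {set {set V}} | `[< good E >]].
have [E|E|X [U [kU UL]]] := @simultaneously_negative R V L.
- by rewrite mem_filter => /andP[/asboolP[]].
- by rewrite mem_filter => /andP[/asboolP[]].
have [X0 _ _] := kU.
exists (X * 'I_3)%type, (tensor U (product_kernel (@skewed R))).
split; first exact: discrete_kernel_tensor kU (discrete_kernel_skewed R).
move=> F; rewrite !discrete_density_tensor; split.
  by move=> [v v1]; rewrite (discrete_density_skewed_eq0 _ v1) mulr0.
move=> FV F1 Fneg [Fc _ _].
have UF : discrete_density U (eset F) < 0.
  apply: UL; rewrite mem_filter mem_enum andbT; apply/asboolP.
  split; rewrite -?card_gt0 -?FV //; last exact: nonpositive_finite.
  by move=> e; exact: edge_neq0.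
split=> [|F_deg]; last by rewrite nmulr_rlt0 // discrete_density_skewed_gt0.
by rewrite nmulr_rle0 // discrete_density_skewed_ge0.
Qed.

Local Close Scope ring_scope.
Local Close Scope classical_set_scope.

Theorem theorem4p1 (R : realType) (r : nat) (V : finType) (H : rhypergraph V r)
    (hr : r = 2 \/ (3 <= r)%N /\ odd r)
    (hH : exists2 m : nat, (0 < m)%N &
       exists F0 : rhypergraph V r,
         [/\ subgraph F0 H, #|eset F0| = (2 * m)%N, ~ positive_hypergraph R F0,
             two_connected F0 &
             forall F : rhypergraph V r, subgraph F H -> F <> F0 ->
               (0 < #|eset F|)%N -> ~~ odd #|eset F| ->
               (#|eset F| <= 2 * m)%N ->
               (~ positive_hypergraph R F /\ two_connected F) \/
               (exists2 v, v \in vset F & vdegree F v = 1%N)]) :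
  ~ common_hypergraph R H.
Proof.
have r2 : (2 <= r)%N by case: hr => [->//|[/ltnW]].
have [m m0 [F0 [[F0H F0V] F0m F0neg F0conn small]]] := hH.
have [X [U [kU UF]]] := negative_kernel R V (ltnW r2).
have F0_gt0 : (0 < #|eset F0|)%N by rewrite F0m muln_gt0.
have [_ /(_ F0V F0_gt0 F0neg F0conn)[U0 U0lt]] := UF F0.
have UF0 : (discrete_density U (eset F0) < 0)%R.
  by apply/U0lt/two_connected_degree; rewrite // F0m; lia.
have Usmall (E : {set {set V}}) : E \subset eset H -> E != finset.set0 ->
    ~~ odd #|E| -> (#|E| <= 2 * m)%N -> (discrete_density U E <= 0)%R.
  move=> EH E0 Eeven Em.
  (* An edge set [E] becomes a subgraph on the vertices that it covers, to which the hypothesis on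
     small subgraphs applies unless it is [F0] itself. *)
  have Eunif :
      [forall (e | e \in E), (e \subset finset.cover E) && (#|e| == r)].
    apply/forall_inP => e eE; rewrite (finset.bigcup_sup e) //=.
    by have /forall_inP/(_ e (fintype.subsetP EH e eE))/andP[] := edge_uniform H.
  pose F := RGraph Eunif.
  have E1 : (0 < #|E|)%N by rewrite card_gt0.
  have [FF0|FF0] := pselect (F = F0).
    by have -> : E = eset F0 by rewrite -FF0.
  have FH : subgraph F H by split.
  have [UF1 UF2] := UF F.
  have [[Fneg Fconn]|[v _ v1]] := small F FH FF0 E1 Eeven Em.
    by have [] := UF2 erefl E1 Fneg Fconn.
  by rewrite UF1 //; exists v.
have [K [Ksym K01 Kneg]] := uncommon_finite kU m0 F0H F0m UF0 Usmall.
have [X0 _ _] := kU.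
by move=> /(common_step_kernel X0 Ksym K01); rewrite leNgt Kneg.
Qed.
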